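(* Let $S=\{p\in\mathbb{R}^{C}: Ap\ge b,\ p\ge 0\}$ be the (nonempty, bounded) feasible region of the pricing problem $$opt=\max_{p\in S}\ f(p),\qquad f(p)=\sum_{i\in\mathcal I}\sum_{n\in\mathcal N}\sum_{\ell=1}^{L}\frac{w_{\ell n}\,p_i}{f_{in\ell}(p)},$$ where $f_{in\ell}(p)=\sum_{j\in\mathcal C}\exp\big(V_{jn\ell}(p)-V_{in\ell}(p)\big)$. For each iteration $m=1,2,\dots$ let $S^m_1,\dots,S^m_{K^m}$ be the parts into which the branching method has partitioned $S$ after $m$ iterations, and let $opt^m$ be the upper bound on $opt$ obtained in iteration $m$ from the convex relaxations over these parts (all as defined in the context). Let $\mathcal B_t(p)$ denote the Euclidean ball with center $p$ and radius $t$, and set $$t^m:=\max_{k=1,\dots,K^m}\ \min\left\{t\ge 0:\ S^m_k\subseteq \mathcal B_t(p)\ \text{for some } p\in S^m_k\right\}.$$ If $t^m\to 0$ as $m\to+\infty$, then $opt^m\searrow opt$; that is, the sequence of upper bounds $(opt^m)_m$ is non-increasing and converges to the optimal value $opt$.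
   Context: **Problem data.** $\mathcal C$ is a finite nonempty set of $C$ alternatives, $\mathcal I\subseteq\mathcal C$ is the subset of alternatives offered by the seller, $\mathcal N$ is a finite set of customers, and $L\ge1$ is an integer. The numbers $w_{\ell n}\ge 0$ satisfy $\sum_{\ell=1}^{L} w_{\ell n}=1$ for each $n\in\mathcal N$. For $j\in\mathcal C$, $n\in\mathcal N$, $\ell\in\{1,\dots,L\}$ the utility is the affine function $V_{jn\ell}(p)=\beta_{jn\ell}\,p_j+q_{jn\ell}$ of $p\in\mathbb R^{C}$, with given real constants $\beta_{jn\ell}, q_{jn\ell}$. $A$ is a real matrix with $C$ columns and $b$ a real vector of matching dimension, such that $S=\{p\in\mathbb R^C: Ap\ge b,\ p\ge0\}$ is nonempty and bounded (a polytope). **Partitions.** For each $m$, $S^m_1,\dots,S^m_{K^m}$ are finitely many nonempty sets whose union is $S$, each of the form $S\cap R$ with $R\subset\mathbb R^C$ a closed axis-parallel box. They arise by branching (repeatedly splitting boxes along a coordinate), so every $S^{m+1}_{k'}$ is contained in some $S^m_k$. **Bounds on a part.** Let $T=S^m_k$ be a part. For $j\in\mathcal C$ put $LB_{p_j}=\min_{p\in T}p_j$ and $UB_{p_j}=\max_{p\in T}p_j$. For $i\in\mathcal I$, $n\in\mathcal N$, $\ell\in\{1,\dots,L\}$ put $$LB_{\tau_{in\ell}}=\Big(\sum_{j\in\mathcal C}\exp\big(\max_{p\in T}\{V_{jn\ell}(p)-V_{in\ell}(p)\}\big)\Big)^{-1},\qquad UB_{\tau_{in\ell}}=\Big(\min_{p\in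 T}f_{in\ell}(p)\Big)^{-1}.$$ **Convex relaxation over a part.** Let $u(T)$ be the optimal value of the following convex problem in the variables $p\in\mathbb R^C$, $\tau=(\tau_{in\ell})$ and $W=(W_{ijn\ell})$, with $i\in\mathcal I$, $j\in\mathcal C$, $n\in\mathcal N$, $\ell\in\{1,\dots,L\}$. Here $W_{i:n\ell}\in\mathbb R^C$ denotes the vector $(W_{ijn\ell})_{j\in\mathcal C}$. Maximize $$\sum_{i\in\mathcal I}\sum_{n\in\mathcal N}\sum_{\ell=1}^{L} w_{\ell n}W_{iin\ell}$$ subject to, for all $i\in\mathcal I$, $j\in\mathcal C$, $n\in\mathcal N$, $\ell\in\{1,\dots,L\}$ (vector inequalities are componentwise): - $Ap\ge b$; - $\tau_{in\ell}\, f_{in\ell}\big(W_{i:n\ell}/\tau_{in\ell}\big)\le 1$; - $A W_{i:n\ell}\ge b\,\tau_{in\ell}$; - $LB_{\tau_{in\ell}}(Ap-b)\le A W_{i:n\ell}-b\,\tau_{in\ell}\le UB_{\tau_{in\ell}}(Ap-b)$; - $W_{ijn\ell}\ge LB_{\tau_{in\ell}}p_j+\tau_{in\ell}LB_{p_j}-LB_{\tau_{in\ell}}LB_{p_j}$; - $W_{ijn\ell}\ge UB_{\tau_{in\ell}}p_j+\tau_{in\ell}UB_{p_j}-UB_{\tau_{in\ell}}UB_{p_j}$; - $W_{ijn\ell}\le UB_{\tau_{in\ell}}p_j+\tau_{in\ell}LB_{p_j}-UB_{\tau_{in\ell}}LB_{p_j}$; - $W_{ijn\ell}\le LB_{\tau_{in\ell}}p_j+\tau_{in\ell}UB_{p_j}-LB_{\tau_{in\ell}}UB_{p_j}$;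 - $LB_{\tau_{in\ell}}\le\tau_{in\ell}\le UB_{\tau_{in\ell}}$ and $LB_{p_j}\le p_j\le UB_{p_j}$. **Upper bound in iteration $m$.** $opt^m=\max_{k=1,\dots,K^m}u(S^m_k)$. *)

(* Defs.v *)
From HB Require Import structures.
From mathcomp Require Import all_boot all_order all_algebra.
From mathcomp Require Import all_classical all_reals all_analysis.
Set Implicit Arguments.
Unset Strict Implicit.
Unset Printing Implicit Defensive.
Import Order.TTheory GRing.Theory Num.Theory.
Import numFieldNormedType.Exports.
Local Open Scope classical_set_scope.
Local Open Scope ring_scope.

(* Alternatives are the elements of 'I_C, customers those of the finite type N
   and customer segments (the index l) those of 'I_L. Price vectors are columns;
   the matrix A has Mc rows. *)
Record pricing (R : realType) (C Mc L : nat) (N : finType) := Pricing {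
  offered : {set 'I_C};
  weight : 'I_L -> N -> R;
  slope : 'I_C -> N -> 'I_L -> R;
  intercept : 'I_C -> N -> 'I_L -> R;
  cstr_mx : 'M[R]_(Mc, C);
  cstr_rhs : 'cV[R]_Mc
}.

Section Definitions.
Variables (R : realType).

Definition lecv (k : nat) (x y : 'cV[R]_k) : Prop := forall i, x i 0 <= y i 0.

Definition box (C : nat) (lo hi : 'cV[R]_C) : set 'cV[R]_C :=
  [set p | lecv lo p /\ lecv p hi].

(* The norm that the library puts on matrices is the sup norm. *)
Definition euclid_norm (C : nat) (x : 'cV[R]_C) : R :=
  Num.sqrt (\sum_j x j 0 ^+ 2).

(* Closed balls, so that the minimum below is attained (e.g. for singletons). *)
Definition euclid_ball (C : nat) (p : 'cV[R]_C) (t : R) : set 'cV[R]_C :=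
  [set x | euclid_norm (x - p) <= t].

(* Every max and min of a real-valued function over S or over a part is written
   with sup and inf: S and the parts are nonempty compact sets, on which these
   extrema are attained. The same holds for the minimal radius. *)
Definition radius (C : nat) (T : set 'cV[R]_C) : R :=
  inf [set t | 0 <= t /\ exists2 p, T p & T `<=` euclid_ball p t].

Variables (C Mc L : nat) (N : finType) (D : pricing R C Mc L N).
Local Notation A := (cstr_mx D).
Local Notation b := (cstr_rhs D).
Implicit Types (p : 'cV[R]_C) (T : set 'cV[R]_C).

Definition utility (j : 'I_C) (n : N) (l : 'I_L) p : R :=
  slope D j n l * p j 0 + intercept D j n l.

Definition denom (i : 'I_C) (n : N) (l : 'I_L) p : R :=
  \sum_j expR (utility j n l p - utility i n l p).

Definition revenue p : R :=
  \sum_(i in offered D) \sum_n \sum_l weight D l n * p i 0 / denom i n l p.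

Definition feasible : set 'cV[R]_C := [set p | lecv b (A *m p) /\ lecv 0 p].

Definition opt : R := sup [set revenue p | p in feasible].

Definition LBp T (j : 'I_C) : R := inf [set p j 0 | p in T].
Definition UBp T (j : 'I_C) : R := sup [set p j 0 | p in T].

Definition LBtau T (i : 'I_C) (n : N) (l : 'I_L) : R :=
  (\sum_j expR (sup [set utility j n l p - utility i n l p | p in T]))^-1.
Definition UBtau T (i : 'I_C) (n : N) (l : 'I_L) : R :=
  (inf [set denom i n l p | p in T])^-1.

(* W i n l is the vector W_{i:nl}, so that W i n l j 0 is W_{ijnl}. The entries
   of tau and W with i not offered are neither constrained nor used. *)
Record relax_feasible T p (tau : 'I_C -> N -> 'I_L -> R)
    (W : 'I_C -> N -> 'I_L -> 'cV[R]_C) : Prop := RelaxFeasible {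
  relax_price : lecv b (A *m p);
  relax_price_bounds : forall j, LBp T j <= p j 0 <= UBp T j;
  relax_tau_bounds : forall i n l, i \in offered D ->
    LBtau T i n l <= tau i n l <= UBtau T i n l;
  relax_perspective : forall i n l, i \in offered D ->
    tau i n l * denom i n l ((tau i n l)^-1 *: W i n l) <= 1;
  relax_scaled : forall i n l, i \in offered D ->
    lecv (tau i n l *: b) (A *m W i n l);
  relax_rlt_lb : forall i n l, i \in offered D ->
    lecv (LBtau T i n l *: (A *m p - b)) (A *m W i n l - tau i n l *: b);
  relax_rlt_ub : forall i n l, i \in offered D ->
    lecv (A *m W i n l - tau i n l *: b) (UBtau T i n l *: (A *m p - b));
  relax_mccormick_ll : forall i j n l, i \in offered D ->
    LBtau T i n l * p j 0 + tau i n l * LBp T j - LBtau T i n l * LBp T j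
      <= W i n l j 0;
  relax_mccormick_uu : forall i j n l, i \in offered D ->
    UBtau T i n l * p j 0 + tau i n l * UBp T j - UBtau T i n l * UBp T j
      <= W i n l j 0;
  relax_mccormick_ul : forall i j n l, i \in offered D ->
    W i n l j 0 <=
      UBtau T i n l * p j 0 + tau i n l * LBp T j - UBtau T i n l * LBp T j;
  relax_mccormick_lu : forall i j n l, i \in offered D ->
    W i n l j 0 <=
      LBtau T i n l * p j 0 + tau i n l * UBp T j - LBtau T i n l * UBp T j
}.

Definition relax_objective (W : 'I_C -> N -> 'I_L -> 'cV[R]_C) : R :=
  \sum_(i in offered D) \sum_n \sum_l weight D l n * W i n l i 0.

(* Optimal value of the relaxation, in the extended reals (-oo if infeasible). *)
Definition relax_value T : \bar R :=
  ereal_sup [set z | exists p tau W,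
    relax_feasible T p tau W /\ z = (relax_objective W)%:E].

(* K m is the number of parts and part m k the k-th part; the index m : nat
   stands for iteration m + 1. *)
Variables (K : nat -> nat) (part : forall m, 'I_(K m) -> set 'cV[R]_C).

Definition branching : Prop :=
  [/\ forall m (k : 'I_(K m)), part k !=set0,
      forall m, \bigcup_(k in [set: 'I_(K m)]) part k = feasible,
      forall m (k : 'I_(K m)), exists lo hi, part k = feasible `&` box lo hi
    & forall m (k' : 'I_(K m.+1)), exists k : 'I_(K m), part k' `<=` part k].

Definition upper_bound (m : nat) : \bar R :=
  \big[maxe/-oo%E]_(k < K m) relax_value (part k).

(* Radii are nonnegative, so 0 is a neutral start for the maximum. *)
Definition max_radius (m : nat) : R :=
  \big[Num.max/0]_(k < K m) radius (part k).

End Definitions.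

(* Main.v *)
Require Import Defs.
From HB Require Import structures.
From mathcomp Require Import all_boot all_order all_algebra.
From mathcomp Require Import all_classical all_reals all_analysis.
From mathcomp Require Import ring lra.
Set Implicit Arguments.
Unset Strict Implicit.
Unset Printing Implicit Defensive.
Import Order.TTheory GRing.Theory Num.Theory.
Import numFieldNormedType.Exports.
Local Open Scope classical_set_scope.
Local Open Scope ring_scope.

(** Shrinking a part tightens every bound, so the relaxation over a subpart is
    the more constrained one; this gives monotonicity. The point
    [tau = 1 / f(p)], [W = tau p] shows that the relaxation over a part
    dominates the revenue of each of its points. Conversely the McCormick
    inequality [W <= UBtau p + tau LBp - UBtau LBp], together with
    [tau <= UBtau] and [p <= UBp], forces [W_i <= UBtau UBp_i]. On a part whose
    coordinates vary by at most [d], the logit denominators vary by a factor at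
    most [exp (2 B d)], where [B] bounds the slopes, and they are at least 1;
    hence the relaxation is at most [exp (2 B d) (opt + d w)], where [w] is the
    sum of [w_ln] over all offered alternatives, customers and segments. *)

(** * Extrema of a real function over a set *)

Section ImageExtrema.
Context {R : realType} {X : Type}.
Implicit Types (f : X -> R) (S : set X).

(** The bound [a] witnesses that the image is bounded below; without such a witness [inf] could be
    the default value 0. The same goes for [sup] below. *)
Lemma inf_image_le f S a x : (forall y, S y -> a <= f y) -> S x ->
  inf [set f y | y in S] <= f x.
Proof.
move=> aS Sx; apply: ge_inf; last by exists x.
by exists a => _ [y Sy <-]; exact: aS.
Qed.

Lemma le_inf_image f S a : S !=set0 -> (forall y, S y -> a <= f y) ->
  a <= inf [set f y | y in S].
Proof.
move=> [x Sx] aS; apply: lb_le_inf; first by exists (f x), x.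
by move=> _ [y Sy <-]; exact: aS.
Qed.

Lemma le_sup_image f S a x : (forall y, S y -> f y <= a) -> S x ->
  f x <= sup [set f y | y in S].
Proof.
move=> Sa Sx; apply: ub_le_sup; last by exists x.
by exists a => _ [y Sy <-]; exact: Sa.
Qed.

Lemma sup_image_le f S a : S !=set0 -> (forall y, S y -> f y <= a) ->
  sup [set f y | y in S] <= a.
Proof.
move=> [x Sx] Sa; apply: ge_sup; first by exists (f x), x.
by move=> _ [y Sy <-]; exact: Sa.
Qed.

End ImageExtrema.

(** * Coordinates, the Euclidean norm and the radius of a part *)

Lemma normr_coord_le {R : realType} {m n : nat} (A : 'M[R]_(m, n)) i j :
  `|A i j| <= `|A|.
Proof.
rewrite -[leRHS]/(mx_norm A) mx_normrE.
by apply/bigmax_geP; right => /=; exists (i, j).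
Qed.

Lemma normr_coord_euclid {R : realType} {C : nat} (x : 'cV[R]_C) j :
  `|x j 0| <= euclid_norm x.
Proof.
rewrite /euclid_norm -sqrtr_sqr ler_wsqrtr // (bigD1 j) //= lerDl.
by apply: sumr_ge0 => k _; exact: sqr_ge0.
Qed.

Lemma euclid_norm_le {R : realType} {C : nat} (x : 'cV[R]_C) (a : R) :
  (forall j, `|x j 0| <= a) -> euclid_norm x <= Num.sqrt (a ^+ 2 *+ C).
Proof.
move=> xa; rewrite /euclid_norm ler_wsqrtr //.
have -> : a ^+ 2 *+ C = \sum_(j < C) a ^+ 2 by rewrite sumr_const card_ord.
apply: ler_sum => j _; rewrite -real_normK ?num_real //.
by rewrite lerXn2r // nnegrE (le_trans _ (xa j)).
Qed.

(** Triangle inequality through the centre of an enclosing ball. The bounds on the coordinates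
    ensure that such a ball exists, so that the infimum in [radius] is meaningful. *)
Lemma coord_dist_le_radius {R : realType} {C : nat} (T : set 'cV[R]_C) (a : R) :
  (forall p j, T p -> 0 <= p j 0 <= a) ->
  forall x y j, T x -> T y -> `|x j 0 - y j 0| <= 2 * Defs.radius T.
Proof.
move=> Ta x y j Tx Ty; apply/ler_addgt0Pr => e e0.
have e20 : 0 < e / 2 by rewrite divr_gt0.
(* A radius within [e / 2] of the infimum spares showing that the infimum is attained; using it for
   both [x] and [y] costs [e] in total. *)
have [||t [t0 [p Tp Tpt]] tlt] :=
  @inf_lt R [set t | 0 <= t /\ exists2 p, T p & T `<=` euclid_ball p t]
    (Defs.radius T + e / 2).
(* This is the diagonal of a cube of side [a], so the ball around any point of [T] contains [T]. *)
- exists (Num.sqrt (a ^+ 2 *+ C)); split; first exact: sqrtr_ge0.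
  exists x => // z Tz; apply: euclid_norm_le => k; rewrite !mxE ler_norml.
  by move: (Ta _ k Tx) (Ta _ k Tz); lra.
- by rewrite ltrDl.
have xp := le_trans (normr_coord_euclid (x - p) j) (Tpt _ Tx).
have yp := le_trans (normr_coord_euclid (y - p) j) (Tpt _ Ty).
have -> : x j 0 - y j 0 = (x - p) j 0 - (y - p) j 0 by rewrite !mxE; ring.
apply: (le_trans (ler_normB _ _)); lra.
Qed.

(** * Variation of utilities and logit denominators *)

Section Relaxation.
Context {R : realType} {C Mc L : nat} {N : finType} (D : pricing R C Mc L N).
Implicit Types (p x y : 'cV[R]_C) (T : set 'cV[R]_C).

(** A sum in place of a maximum: any common bound on the absolute slopes will do. *)
Definition slope_bound : R :=
  \sum_(u : 'I_C * N * 'I_L) `|slope D u.1.1 u.1.2 u.2|.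

Definition total_weight : R :=
  \sum_(i in offered D) \sum_n \sum_l weight D l n.

Lemma slope_le j n l : `|slope D j n l| <= slope_bound.
Proof.
by rewrite /slope_bound (bigD1 (j, n, l)) //= lerDl sumr_ge0.
Qed.

Lemma slope_bound_ge0 : 0 <= slope_bound.
Proof. exact: sumr_ge0. Qed.

(** Each of the two affine utilities changes by at most [slope_bound * d], whence the factor 2. *)
Lemma utility_gap_le j i n l d x y : (forall k, `|x k 0 - y k 0| <= d) ->
  utility D j n l x - utility D i n l x <=
  utility D j n l y - utility D i n l y + 2 * slope_bound * d.
Proof.
move=> xyd.
have key k : `|slope D k n l * (x k 0 - y k 0)| <= slope_bound * d.
  by rewrite normrM ler_pM // slope_le.
move: (key i) (key j); rewrite /utility !ler_norml; lra.
Qed.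

Lemma denom_le i n l d x y : (forall k, `|x k 0 - y k 0| <= d) ->
  denom D i n l x <= expR (2 * slope_bound * d) * denom D i n l y.
Proof.
move=> xyd; rewrite /denom mulr_sumr; apply: ler_sum => j _.
by rewrite -expRD ler_expR [leRHS]addrC utility_gap_le.
Qed.

Lemma denom_ge1 i n l p : 1 <= denom D i n l p.
Proof.
rewrite /denom (bigD1 i) //= subrr expR0 lerDl.
by apply: sumr_ge0 => j _; exact: expR_ge0.
Qed.

Lemma denom_gt0 i n l p : 0 < denom D i n l p.
Proof. exact: lt_le_trans ltr01 (denom_ge1 i n l p). Qed.

(** * Bounds and relaxation over a single part *)

Section Part.
Variables (T : set 'cV[R]_C) (a : R).
Hypotheses (T0 : T !=set0) (Ta : forall p j, T p -> 0 <= p j 0 <= a).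

Lemma part_LBp_le p j : T p -> LBp T j <= p j 0.
Proof.
by apply: (@inf_image_le _ _ (fun p => p j 0) _ 0) => y /(Ta j)/andP[].
Qed.

Lemma part_UBp_ge p j : T p -> p j 0 <= UBp T j.
Proof.
by apply: (@le_sup_image _ _ (fun p => p j 0) _ a) => y /(Ta j)/andP[].
Qed.

Lemma LBp_ge0 j : 0 <= LBp T j.
Proof. by apply: le_inf_image => // y /(Ta j)/andP[]. Qed.

Lemma utility_gap_le_sup j i n l p : T p ->
  utility D j n l p - utility D i n l p <=
  sup [set utility D j n l p - utility D i n l p | p in T].
Proof.
case: T0 => q Tq.
(* The gap is bounded above on [T] by comparison with a fixed [q], since coordinates in [T] differ
   by at most [a]. *)
apply: (@le_sup_image _ _ (fun p => utility D j n l p - utility D i n l p) _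
  (utility D j n l q - utility D i n l q + 2 * slope_bound * a)) => y Ty.
apply: utility_gap_le => k; rewrite ler_norml.
by move: (Ta k Ty) (Ta k Tq); lra.
Qed.

Lemma inf_denom_le i n l p : T p ->
  inf [set denom D i n l p | p in T] <= denom D i n l p.
Proof. by apply: (@inf_image_le _ _ _ _ 1) => y _; exact: denom_ge1. Qed.

Lemma inf_denom_gt0 i n l : 0 < inf [set denom D i n l p | p in T].
Proof.
apply: (lt_le_trans ltr01); apply: le_inf_image => // y _; exact: denom_ge1.
Qed.

Lemma UBtau_ge0 i n l : 0 <= UBtau D T i n l.
Proof. by rewrite invr_ge0 ltW // inf_denom_gt0. Qed.

Lemma denom_le_sup i n l p : T p -> denom D i n l p <=
  \sum_j expR (sup [set utility D j n l p - utility D i n l p | p in T]).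
Proof.
by move=> Tp; apply: ler_sum => j _; rewrite ler_expR utility_gap_le_sup.
Qed.

Lemma part_LBtau_le i n l p : T p -> LBtau D T i n l <= (denom D i n l p)^-1.
Proof.
move=> Tp; have dp := denom_le_sup i n l Tp.
by rewrite lef_pV2 // posrE ?denom_gt0 // (lt_le_trans (denom_gt0 i n l p)).
Qed.

Lemma part_UBtau_ge i n l p : T p -> (denom D i n l p)^-1 <= UBtau D T i n l.
Proof.
by move=> Tp; rewrite lef_pV2 ?posrE ?denom_gt0 ?inf_denom_gt0 ?inf_denom_le.
Qed.

Lemma revenue_le_relax_value p : T p -> feasible D p ->
  ((revenue D p)%:E <= relax_value D T)%E.
Proof.
move=> Tp [bp p0]; apply: ereal_sup_ubound.
pose tau i n l := (denom D i n l p)^-1.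
have LBp_p j := part_LBp_le j Tp.
have p_UBp j := part_UBp_ge j Tp.
have LB_tau i n l : LBtau D T i n l <= tau i n l := part_LBtau_le i n l Tp.
have tau_UB i n l : tau i n l <= UBtau D T i n l := part_UBtau_ge i n l Tp.
have tau_gt0 i n l : 0 < tau i n l by rewrite invr_gt0 denom_gt0.
exists p, tau, (fun i n l => tau i n l *: p); split; last first.
  congr (_%:E); apply: eq_bigr => i _; apply: eq_bigr => n _.
  by apply: eq_bigr => l _; rewrite mxE -mulrA [p i 0 * _]mulrC.
have Ap_b k : 0 <= (cstr_mx D *m p) k 0 - cstr_rhs D k 0 by rewrite subr_ge0.
split=> //.
- by move=> j; rewrite LBp_p p_UBp.
- by move=> i n l _; rewrite LB_tau tau_UB.
(* Since [W / tau = p], the perspective constraint holds with equality. *)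
- move=> i n l _; rewrite scalerA mulVf ?gt_eqF // scale1r /tau.
  by rewrite mulVf // gt_eqF // denom_gt0.
- move=> i n l _ k; rewrite -scalemxAr !mxE ler_pM2l //.
  by have := bp k; rewrite mxE.
(* Here [A W - tau b = tau (A p - b)] with [A p - b >= 0], so the bounds on [tau] suffice. *)
- move=> i n l _ k; rewrite -scalemxAr -scalerBr mxE [leRHS]mxE.
  by rewrite ler_wpM2r // !mxE; have := Ap_b k; rewrite !mxE.
- move=> i n l _ k; rewrite -scalemxAr -scalerBr mxE [leRHS]mxE.
  by rewrite ler_wpM2r // !mxE; have := Ap_b k; rewrite !mxE.
(* Each McCormick inequality expands a product of two nonnegative slacks, such as
   [(tau - LBtau) (p - LBp) >= 0]. *)
- move=> i j n l _; rewrite mxE.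
  by move: (LB_tau i n l) (LBp_p j); nra.
- move=> i j n l _; rewrite mxE.
  by move: (tau_UB i n l) (p_UBp j); nra.
- move=> i j n l _; rewrite mxE.
  by move: (tau_UB i n l) (LBp_p j); nra.
- move=> i j n l _; rewrite mxE.
  by move: (LB_tau i n l) (p_UBp j); nra.
Qed.

(** The McCormick bound equals [UBtau p - (UBtau - tau) LBp], and the subtracted term is nonnegative
    because prices are. *)
Lemma relax_W_le p tau W i n l : relax_feasible D T p tau W ->
  i \in offered D -> W i n l i 0 <= UBtau D T i n l * UBp T i.
Proof.
move=> rf iD; have := relax_mccormick_ul rf i n l iD.
have /andP[_] := relax_tau_bounds rf n l iD.
have /andP[] := relax_price_bounds rf i.
move: (UBtau_ge0 i n l) (LBp_ge0 i); nra.
Qed.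

(** By [denom_le], the infimum of the denominators is at least [exp (- 2 B d)] times the one at [q];
    inverting gives the bound. *)
Lemma UBtau_le d i n l q : T q ->
  (forall x y j, T x -> T y -> `|x j 0 - y j 0| <= d) ->
  UBtau D T i n l <= expR (2 * slope_bound * d) * (denom D i n l q)^-1.
Proof.
move=> Tq Td; rewrite -[expR _]invrK -invfM lef_pV2 ?posrE ?inf_denom_gt0 //.
  apply: le_inf_image => // y Ty; rewrite ler_pdivrMl ?expR_gt0 //.
  by apply: denom_le => k; exact: Td.
by rewrite mulr_gt0 ?denom_gt0 // invr_gt0 expR_gt0.
Qed.

Lemma UBp_le d j q : T q ->
  (forall x y j, T x -> T y -> `|x j 0 - y j 0| <= d) -> UBp T j <= q j 0 + d.
Proof.
move=> Tq Td; apply: sup_image_le => // y Ty.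
by have := Td _ _ j Ty Tq; rewrite ler_norml; lra.
Qed.

Lemma relax_objective_le d p tau W q :
  (forall l n, 0 <= weight D l n) -> T q ->
  (forall x y j, T x -> T y -> `|x j 0 - y j 0| <= d) ->
  relax_feasible D T p tau W ->
  relax_objective D W <=
    expR (2 * slope_bound * d) * (revenue D q + d * total_weight).
Proof.
move=> w0 Tq Td rf.
rewrite /revenue /total_weight [d * _]mulr_sumr -big_split [expR _ * _]mulr_sumr.
apply: ler_sum => i iD /=; rewrite [d * _]mulr_sumr -big_split [expR _ * _]mulr_sumr.
apply: ler_sum => n _ /=; rewrite [d * _]mulr_sumr -big_split [expR _ * _]mulr_sumr.
apply: ler_sum => l _ /=.
(* Only inside the sum is there a coordinate [i] at which [Td] yields this sign. *)
have d0 : 0 <= d by apply: le_trans (Td _ _ i Tq Tq).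
have q0 : 0 <= q i 0 by case/andP: (Ta i Tq).
have V1 : (denom D i n l q)^-1 <= 1 by rewrite invf_le1 ?denom_ge1 ?denom_gt0.
have UBp0 : 0 <= UBp T i by rewrite (le_trans q0) // part_UBp_ge.
have -> (e w v : R) : e * (w * q i 0 * v + d * w) = w * (e * (q i 0 * v + d)).
  by ring.
rewrite ler_wpM2l ?w0 //.
apply: (le_trans (relax_W_le n l rf iD)).
apply: (le_trans (ler_pM (UBtau_ge0 i n l) UBp0
  (UBtau_le i n l Tq Td) (UBp_le i Tq Td))).
(* With [v] the inverse denominator at [q], what remains is [v (q + d) <= q v + d], which follows
   from [v <= 1]. *)
rewrite -[leLHS]mulrA ler_wpM2l ?expR_ge0 //; nra.
Qed.

End Part.

(** * Monotonicity of the bounds and of the relaxation in the part *)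

Lemma LBp_subset T T' a j : T' !=set0 -> T' `<=` T ->
  (forall p j, T p -> 0 <= p j 0 <= a) -> LBp T j <= LBp T' j.
Proof.
by move=> T'0 sT Ta; apply: le_inf_image => // y /sT; exact: (part_LBp_le Ta).
Qed.

Lemma UBp_subset T T' a j : T' !=set0 -> T' `<=` T ->
  (forall p j, T p -> 0 <= p j 0 <= a) -> UBp T' j <= UBp T j.
Proof.
by move=> T'0 sT Ta; apply: sup_image_le => // y /sT; exact: (part_UBp_ge Ta).
Qed.

Lemma LBtau_subset T T' a i n l : T' !=set0 -> T' `<=` T ->
  (forall p j, T p -> 0 <= p j 0 <= a) ->
  LBtau D T i n l <= LBtau D T' i n l.
Proof.
move=> T'0 sT Ta.
have sum_gt0 (g : 'I_C -> R) : 0 < \sum_j expR (g j).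
  rewrite (bigD1 i) //= ltr_pwDl ?expR_gt0 //.
  by apply: sumr_ge0 => j _; exact: expR_ge0.
rewrite lef_pV2 ?posrE //; apply: ler_sum => j _; rewrite ler_expR.
apply: sup_image_le => // y /sT Ty.
apply: (utility_gap_le_sup _ Ta) => //; by exists y.
Qed.

Lemma UBtau_subset T T' i n l : T' !=set0 -> T' `<=` T ->
  UBtau D T' i n l <= UBtau D T i n l.
Proof.
move=> T'0 sT; have T0 : T !=set0 by case: T'0 => y /sT; exists y.
rewrite lef_pV2 ?posrE ?inf_denom_gt0 //.
by apply: le_inf_image => // y /sT; exact: inf_denom_le.
Qed.

Lemma relax_feasible_subset T T' a p tau W : T' !=set0 -> T' `<=` T ->
  (forall p j, T p -> 0 <= p j 0 <= a) ->
  relax_feasible D T' p tau W -> relax_feasible D T p tau W.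
Proof.
move=> T'0 sT Ta rf.
have lp j : LBp T j <= LBp T' j := LBp_subset j T'0 sT Ta.
have up j : UBp T' j <= UBp T j := UBp_subset j T'0 sT Ta.
have lt i n l : LBtau D T i n l <= LBtau D T' i n l :=
  LBtau_subset i n l T'0 sT Ta.
have ut i n l : UBtau D T' i n l <= UBtau D T i n l :=
  UBtau_subset i n l T'0 sT.
have pP j := relax_price_bounds rf j.
have Ap_b k : 0 <= (cstr_mx D *m p - cstr_rhs D) k 0.
  by have := relax_price rf k; rewrite !mxE subr_ge0.
have tP i n l (iD : i \in offered D) := relax_tau_bounds rf n l iD.
split.
- exact: relax_price rf.
- by move=> j; move: (pP j) (lp j) (up j); lra.
- by move=> i n l /(tP i n l); move: (lt i n l) (ut i n l); lra.
- exact: relax_perspective rf.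
- exact: relax_scaled rf.
(* As [A p - b >= 0], a smaller [LBtau] or a larger [UBtau] weakens these constraints. *)
- move=> i n l iD k; apply: le_trans (relax_rlt_lb rf n l iD k).
  by rewrite mxE [leRHS]mxE ler_wpM2r.
- move=> i n l iD k; apply: le_trans (relax_rlt_ub rf n l iD k) _.
  by rewrite mxE [leRHS]mxE ler_wpM2r.
(* The gap between the true product [tau * p] and its McCormick estimate is a
   product of two slacks, each of which is larger for looser bounds. *)
- move=> i j n l iD; have := relax_mccormick_ll rf j n l iD.
  by move: (tP i n l iD) (pP j) (lp j) (lt i n l); nra.
- move=> i j n l iD; have := relax_mccormick_uu rf j n l iD.
  by move: (tP i n l iD) (pP j) (up j) (ut i n l); nra.
- move=> i j n l iD; have := relax_mccormick_ul rf j n l iD.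
  by move: (tP i n l iD) (pP j) (lp j) (ut i n l); nra.
- move=> i j n l iD; have := relax_mccormick_lu rf j n l iD.
  by move: (tP i n l iD) (pP j) (up j) (lt i n l); nra.
Qed.

Lemma relax_value_subset T T' a : T' !=set0 -> T' `<=` T ->
  (forall p j, T p -> 0 <= p j 0 <= a) ->
  (relax_value D T' <= relax_value D T)%E.
Proof.
move=> T'0 sT Ta; apply: ereal_sup_le => _ [p [tau [W [rf ->]]]].
by exists p, tau, W; split=> //; exact: relax_feasible_subset Ta rf.
Qed.

(** * Boundedness of prices and revenue over the feasible region *)

Lemma feasible_coord_bound : bounded_set (feasible D) ->
  exists a, forall p j, feasible D p -> 0 <= p j 0 <= a.
Proof.
(* [bounded_set] provides a norm bound only for numbers strictly above [M]. *)
move=> [M [_ hM]]; exists (M + 1) => p j pS.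
have /hM/(_ _ pS)/= pM : M < M + 1 by rewrite ltrDl.
have p0 : 0 <= p j 0 by case: pS => _ /(_ j); rewrite mxE.
rewrite p0 /=; apply: le_trans pM.
by apply: le_trans (normr_coord_le p j 0); exact: ler_norm.
Qed.

(** The supremum is a genuine bound because revenue is bounded: denominators are at least 1, so each
    term is at most [w a]. *)
Lemma revenue_le_opt a p :
  (forall l n, 0 <= weight D l n) ->
  (forall p j, feasible D p -> 0 <= p j 0 <= a) ->
  feasible D p -> revenue D p <= opt D.
Proof.
move=> w0 Sa; apply: (@le_sup_image _ _ (revenue D) _
  (\sum_(i in offered D) \sum_n \sum_l weight D l n * a)) => y Sy.
apply: ler_sum => i _; apply: ler_sum => n _; apply: ler_sum => l _.
have /andP[y0 ya] := Sa _ i Sy.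
rewrite ler_pdivrMr ?denom_gt0 // -mulrA ler_wpM2l ?w0 //.
by move: (denom_ge1 i n l y); nra.
Qed.

(** * The sequence of upper bounds *)

Section Branching.
Variables (K : nat -> nat) (part : forall m : nat, 'I_(K m) -> set 'cV[R]_C).
Variable a : R.
Hypotheses (w0 : forall l n, 0 <= weight D l n) (S0 : feasible D !=set0).
Hypothesis Sa : forall p j, feasible D p -> 0 <= p j 0 <= a.
Hypothesis branchingP : branching D part.

Lemma part_feasible m (k : 'I_(K m)) : part k `<=` feasible D.
Proof. by case: branchingP => _ _ /(_ m k)[lo [hi ->]] _ x []. Qed.

Lemma part_coord_bound m (k : 'I_(K m)) p j : part k p -> 0 <= p j 0 <= a.
Proof. by move=> /part_feasible; exact: Sa. Qed.

Lemma upper_bound_nonincreasing : nonincreasing_seq (upper_bound D part).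
Proof.
apply/nonincreasing_seqP => m; case: branchingP => part0 _ _ refine.
apply/bigmax_leP; split=> [|k' _]; first exact: leNye.
have [k sk] := refine m k'.
apply: le_trans (le_bigmax _ (fun k => relax_value D (part k)) k).
by apply: relax_value_subset sk (@part_coord_bound m k); exact: part0.
Qed.

Lemma opt_le_upper_bound m : ((opt D)%:E <= upper_bound D part m)%E.
Proof.
case: branchingP => part0 cover _ _.
have rev_le p : feasible D p -> ((revenue D p)%:E <= upper_bound D part m)%E.
  move=> pS; move: (pS); rewrite -(cover m) => -[k _ kp].
  apply: le_trans (le_bigmax _ (fun k => relax_value D (part k)) k).
  by apply: revenue_le_relax_value (@part_coord_bound m k) _ kp pS.
(* The value [+oo] is trivial, and [-oo] is excluded by the revenue of a feasible point. *)
case: (upper_bound D part m) rev_le => [u||] rev_le; last 2 first.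
- exact: leey.
- by case: S0 => p /rev_le.
by rewrite lee_fin; exact: sup_image_le.
Qed.

(** An explicit error bound: [relax_objective_le] with [d] twice the largest radius, which bounds
    coordinate differences in every part at once, and [revenue q <= opt] at any point [q] of the
    part. *)
Lemma upper_bound_le m : (upper_bound D part m <=
  (expR (2 * slope_bound * (2 * max_radius part m)) *
    (opt D + 2 * max_radius part m * total_weight))%:E)%E.
Proof.
case: branchingP => part0 _ _ _.
apply/bigmax_leP; split=> [|k _]; first exact: leNye.
apply: ge_ereal_sup => _ [p [tau [W [rf ->]]]]; rewrite lee_fin.
have [q kq] := part0 m k.
have kd x y j : part k x -> part k y ->
    `|x j 0 - y j 0| <= 2 * max_radius part m.
  move=> kx ky.
  apply: (le_trans (coord_dist_le_radius (@part_coord_bound m k) j kx ky)).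
  by rewrite ler_pM2l //; exact: (le_bigmax _ (fun k => Defs.radius (part k)) k).
apply: (le_trans (relax_objective_le (part0 m k) (@part_coord_bound m k)
  w0 kq kd rf)).
rewrite ler_wpM2l ?expR_ge0 // lerD2r.
by apply: revenue_le_opt Sa _ => //; exact: part_feasible kq.
Qed.

Lemma upper_bound_cvg : max_radius part m @[m --> \oo] --> (0 : R) ->
  upper_bound D part m @[m --> \oo] --> (opt D)%:E.
Proof.
move=> r0.
(* The error bound as a function of the radius; it tends to [g 0 = opt], so [upper_bound] is
   squeezed between [opt] and [g]. *)
pose g (r : R) :=
  expR (2 * slope_bound * (2 * r)) * (opt D + 2 * r * total_weight).
have g0 : g 0 = opt D by rewrite /g !(mulr0, mul0r, addr0) expR0 mul1r.
have : g (max_radius part m) @[m --> \oo] --> g 0.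
apply: cvgM.
  apply: continuous_cvg; first exact: continuous_expR.
  by apply: cvgMr; apply: cvgMr.
by apply: cvgD; [exact: cvg_cst|apply: cvgMl; apply: cvgMr].
rewrite g0 => gr.
apply: (@squeeze_cvge _ _ _ _ (fun=> (opt D)%:E) _
  (fun m => (g (max_radius part m))%:E)).
- by near=> m; rewrite opt_le_upper_bound upper_bound_le.
- exact: cvg_cst.
- by apply: cvg_EFin => //; near=> m.
Unshelve. all: by end_near. Qed.

End Branching.

End Relaxation.

Theorem theorem1 (R : realType) (C Mc L : nat) (N : finType)
    (D : pricing R C Mc L N)
    (K : nat -> nat) (part : forall m : nat, 'I_(K m) -> set 'cV[R]_C)
    (C_gt0 : (0 < C)%N) (L_gt0 : (1 <= L)%N)
    (weight_ge0 : forall (l : 'I_L) (n : N), 0 <= weight D l n)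
    (weight_sum1 : forall n : N, \sum_(l < L) weight D l n = 1)
    (S_neq0 : feasible D !=set0)
    (S_bounded : bounded_set (feasible D))
    (branchingP : branching D part) :
  max_radius part m @[m --> \oo] --> (0 : R) ->
  nonincreasing_seq (upper_bound D part) /\
  upper_bound D part m @[m --> \oo] --> (opt D)%:E.
Proof.
have [a Sa] := feasible_coord_bound S_bounded.
move=> r0; split.
  exact: upper_bound_nonincreasing Sa branchingP.
exact: upper_bound_cvg weight_ge0 S_neq0 Sa branchingP r0.
Qed.
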